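(* The following filling-shape-Wilf-equivalences of consecutive patterns hold: $$13452\equiv_{\mathrm{fs}}13542\equiv_{\mathrm{fs}}14352\equiv_{\mathrm{fs}}14532\equiv_{\mathrm{fs}}15342\equiv_{\mathrm{fs}}15432,$$ $$12453\equiv_{\mathrm{fs}}12543,\qquad 24153\equiv_{\mathrm{fs}}25143.$$
   Context: Two sequences of positive integers of the same length are order-isomorphic, $a_1\cdots a_k\sim b_1\cdots b_k$, if for all $p,q$ one has $a_p<a_q$ iff $b_p<b_q$. A consecutive pattern is a permutation $\sigma_1\cdots\sigma_k$ of $\{1,\dots,k\}$, whose occurrences are required to be in adjacent positions, as follows. Young diagrams are drawn in French notation: a Young diagram $D$ with $n$ columns and $m$ rows is a set of cells (column, row) in $\{1,\dots,n\}\times\{1,\dots,m\}$ such that if $(a,b)\in D$ then $(a',b')\in D$ for all $1\le a'\le a$, $1\le b'\le b$; the cell $(1,1)$ is at the bottom left. A filling of $D$ is a set of selected cells of $D$ with no two in the same column and no two in the same row. For a column $c$ containing a selected cell, let $\pi(c)$ be the row of that cell. A filling contains the consecutive pattern $\sigma_1\cdots\sigma_k$ if there are consecutive columns $i_1<\cdots<i_k$ (that is, $i_{p+1}-i_p=1$ for $1\le p\le k-1$) such that $(i_1,\pi(i_1)),\dots,(i_k,\pi(i_k))$ are selected cells, $\pi(i_1)\cdots\pi(i_k)\sim\sigma_1\cdots\sigma_k$, and $(i_p,\pi(i_q))\in D$ for all $1\le p,q\le k$. Otherwise it avoids the pattern. Two patterns $\sigma,\tau$ are filling-shape-Wilf-equivalent,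 $\sigma\equiv_{\mathrm{fs}}\tau$, if for every Young diagram $D$, every set $R$ of rows and every set $C$ of columns, the number of fillings of $D$ avoiding $\sigma$ whose set of rows without a selected cell is exactly $R$ and whose set of columns without a selected cell is exactly $C$ equals the number of such fillings avoiding $\tau$. *)

(* Defs.v *)
From mathcomp Require Import all_boot.

Set Implicit Arguments.
Unset Strict Implicit.
Unset Printing Implicit Defensive.

(* Columns and rows are numbered from 0: the cell (column, row) = (i, j) of
   'I_n * 'I_m is the cell (i + 1, j + 1) of {1..n} x {1..m}. All the notions
   below depend only on the relative order and adjacency of the indices, hence
   are unaffected by the shift. *)

Record pattern := Pattern {
  pattern_seq :> seq nat;
  _ : perm_eq pattern_seq (iota 1 (size pattern_seq))
}.

Definition order_iso (a b : seq nat) : bool :=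
  (size a == size b) &&
  [forall p : 'I_(size a), forall q : 'I_(size a),
    (nth 0 a p < nth 0 a q) == (nth 0 b p < nth 0 b q)].

Section Fillings.

Variables n m : nat.

Implicit Types D F : {set 'I_n * 'I_m}.

Definition young_diagram D : bool :=
  [forall x in D, forall y : 'I_n * 'I_m,
    (y.1 <= x.1) && (y.2 <= x.2) ==> (y \in D)].

Definition filling D F : bool :=
  (F \subset D) &&
  [forall x in F, forall y in F, (x.1 == y.1) || (x.2 == y.2) ==> (x == y)].

(* The columns of an occurrence are c_1, ..., c_k; since F has at most one cell
   in each column, (c_p, r_p) \in F says that r_p is the row pi(c_p). *)
Definition contains D F (s : pattern) : bool :=
  [exists c : (size s).-tuple 'I_n, exists r : (size s).-tuple 'I_m,
    [&& [forall p : 'I_(size s), forall q : 'I_(size s),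
          (val q == p.+1) ==> (val (tnth c q) == (tnth c p).+1)],
        [forall p : 'I_(size s), (tnth c p, tnth r p) \in F],
        order_iso [seq val j | j <- r] s
      & [forall p : 'I_(size s), forall q : 'I_(size s),
          (tnth c p, tnth r q) \in D]]].

Definition empty_rows F : {set 'I_m} :=
  [set j | [forall i : 'I_n, (i, j) \notin F]].

Definition empty_columns F : {set 'I_n} :=
  [set i | [forall j : 'I_m, (i, j) \notin F]].

Definition avoiding_fillings D (s : pattern) (R : {set 'I_m}) (C : {set 'I_n}) :
    {set {set 'I_n * 'I_m}} :=
  [set F | [&& filling D F, ~~ contains D F s,
               empty_rows F == R & empty_columns F == C]].

End Fillings.

Definition fs_equiv (s t : pattern) : Prop :=
  forall (n m : nat) (D : {set 'I_n * 'I_m}), young_diagram D ->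
  forall (R : {set 'I_m}) (C : {set 'I_n}),
    #|avoiding_fillings D s R C| = #|avoiding_fillings D t R C|.

(* Main.v *)
Require Import Defs.
From mathcomp Require Import all_boot.
From mathcomp Require Import zify.

Set Implicit Arguments.
Unset Strict Implicit.
Unset Printing Implicit Defensive.

(** Two distinct occurrences of patterns in { s, t } share at most one column,
    as no proper suffix of length at least 2 of one of the patterns is
    order-isomorphic to a prefix of one of them. Replace simultaneously every
    occurrence of s by one of t and vice versa, permuting the selected cells
    among the columns of the occurrence. Since s and t agree at both ends, a
    column shared by two occurrences is not moved, and the occurrences of s in
    the new filling are exactly those of t in the old one. This is therefore an
    involution; it preserves the diagram because an occurrence spans a rectangle
    of cells of D. *)

Section SwapPatterns.

(** For [s] and [t] of equal size: the suffix of [s] from position [d] is order-isomorphic to a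
    prefix of [t]. Occurrences of [s] and [t] starting [d] columns apart force this. *)
Definition overlap (s t : seq nat) (d : nat) : bool :=
  all (fun p => all (fun q =>
      (nth 0 s (d + p) < nth 0 s (d + q)) == (nth 0 t p < nth 0 t q))
    (iota 0 (size s - d))) (iota 0 (size s - d)).

Variables (P : bool -> pattern) (k : nat).

Hypothesis sizeP : forall b, size (P b) = k.
Hypothesis k_gt2 : 2 < k.
Hypothesis firstP : nth 0 (P true) 0 = nth 0 (P false) 0.
Hypothesis lastP : nth 0 (P true) k.-1 = nth 0 (P false) k.-1.
(** The bound means at least two shared columns; [d = k.-1], a single shared column, is
    permitted. *)
Hypothesis overlapP : forall b b' d, d < k.-1 ->
  overlap (P b) (P b') d -> d = 0 /\ b = b'.

(** * The permutation of positions between the two patterns *)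

Lemma pattern_uniq (s : pattern) : uniq s.
Proof. by case: s => s /= /perm_uniq ->; apply: iota_uniq. Qed.

Lemma mem_pattern (s t : pattern) : size s = size t ->
  pattern_seq s =i pattern_seq t.
Proof.
case: s t => [s ps] [t pt] /= E x.
by rewrite (perm_mem ps) (perm_mem pt) E.
Qed.

(** When an occurrence of [P b] at [a] is swapped, the new column [a + p] receives the old column
    [a + shuffle b p]. *)
Definition shuffle (b : bool) (p : nat) : nat :=
  index (nth 0 (P (~~ b)) p) (P b).

Lemma mem_nth_pattern b b' p : p < k -> nth 0 (P b') p \in pattern_seq (P b).
Proof.
move=> pk; rewrite (@mem_pattern _ (P b')) ?sizeP //.
by apply: mem_nth; rewrite sizeP.
Qed.

Lemma shuffle_lt b p : p < k -> shuffle b p < k.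
Proof. by move=> pk; rewrite -(sizeP b) index_mem mem_nth_pattern. Qed.

Lemma nth_shuffle b p : p < k -> nth 0 (P b) (shuffle b p) = nth 0 (P (~~ b)) p.
Proof. by move=> pk; rewrite nth_index // mem_nth_pattern. Qed.

Lemma shuffleK b p : p < k -> shuffle (~~ b) (shuffle b p) = p.
Proof.
move=> pk; rewrite {1}/shuffle negbK nth_shuffle //.
by rewrite index_uniq ?sizeP ?pattern_uniq.
Qed.

Lemma shuffle_first b : shuffle b 0 = 0.
Proof.
have -> : shuffle b 0 = index (nth 0 (P b) 0) (P b).
  by rewrite /shuffle; case: b; rewrite /= firstP.
by rewrite index_uniq ?pattern_uniq // sizeP; lia.
Qed.

Lemma shuffle_last b : shuffle b k.-1 = k.-1.
Proof.
have -> : shuffle b k.-1 = index (nth 0 (P b) k.-1) (P b).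
  by rewrite /shuffle; case: b; rewrite /= lastP.
by rewrite index_uniq ?pattern_uniq // sizeP; lia.
Qed.

(** * Rearranging columns within separated windows *)

Definition separated (O : bool -> nat -> bool) : Prop :=
  forall b b' a d, d < k.-1 -> O b a -> O b' (a + d) -> d = 0 /\ b = b'.

(** Points backwards: the new column [c] is the old column [swap_col O c]. If [c] lies in two
    windows, [pick] chooses arbitrarily; [swap_col_window] shows that this is harmless. *)
Definition swap_col (O : bool -> nat -> bool) (c : nat) : nat :=
  if [pick x : bool * 'I_k | (x.2 <= c) && O x.1 (c - x.2)] is Some x
  then c - x.2 + shuffle x.1 x.2 else c.

Lemma swap_colP (O : bool -> nat -> bool) c :
  (exists b a p, [/\ O b a, p < k, c = a + p & swap_col O c = a + shuffle b p])
  \/ swap_col O c = c.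
Proof.
rewrite /swap_col; case: pickP => [[b p] /= /andP[le_pc Oba] | _]; last by right.
by left; exists b, (c - p), p; split=> //; rewrite subnK.
Qed.

(** Two windows through one column either coincide or meet only there, as the last column of one and
    the first of the other; [shuffle] fixes both ends. *)
Lemma swap_col_window O b a p : separated O -> O b a -> p < k ->
  swap_col O (a + p) = a + shuffle b p.
Proof.
move=> sepO Oba pk; rewrite /swap_col; case: pickP => [[b' p'] /=|/(_ (b, Ordinal pk))/=];
  last by rewrite leq_addl addnK Oba.
case/andP=> le_p'; set a' := _ - _ => Oba'; have p'k := ltn_ord p'.
have Ea : a' + p' = a + p by rewrite subnK.
have [lt_aa'|lt_a'a|eq_a] := ltngtP a a'.
- have [lt_d|ge_d] := ltnP (a' - a) k.-1.
    by case: (sepO b b' a (a' - a)) => //; [rewrite subnKC // ltnW | lia].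
  have -> : nat_of_ord p' = 0 by lia.
  have -> : p = k.-1 by lia.
  by rewrite shuffle_first shuffle_last; lia.
- have [lt_d|ge_d] := ltnP (a - a') k.-1.
    by case: (sepO b' b a' (a - a')) => //; [rewrite subnKC // ltnW | lia].
  have -> : nat_of_ord p' = k.-1 by lia.
  have -> : p = 0 by lia.
  by rewrite shuffle_first shuffle_last; lia.
- have [_ <-] : 0 = 0 /\ b = b'.
    by apply: (sepO b b' a 0) => //; [lia | rewrite addn0 eq_a].
  by rewrite -eq_a; congr (_ + shuffle _ _); lia.
Qed.

Lemma swap_col_far (O : bool -> nat -> bool) a p : p < k ->
  (forall b' a', O b' a' -> a' + k.-1 <= a \/ a + k.-1 <= a') ->
  swap_col O (a + p) = a + p.
Proof.
move=> pk farO; have [[b' [a' [p' [Ob' p'k E ->]]]]|//] := swap_colP O (a + p).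
have [far|far] := farO _ _ Ob'.
- have -> : p' = k.-1 by lia.
  by rewrite shuffle_last; lia.
- have -> : p' = 0 by lia.
  by rewrite shuffle_first; lia.
Qed.

Lemma swap_colK (O O' : bool -> nat -> bool) c : separated O -> separated O' ->
  (forall b a, O' b a = O (~~ b) a) -> swap_col O' (swap_col O c) = c.
Proof.
move=> sepO sepO' OO'.
have [[b [a [p [Oba pk -> ->]]]]|Ec] := swap_colP O c.
  rewrite (@swap_col_window _ (~~ b)) ?OO' ?negbK ?shuffle_lt //.
  by rewrite shuffleK.
(* An unmoved column may still lie in a window, at a position fixed by [shuffle]; the inverse
   permutation then fixes it too. *)
rewrite Ec; have [[b [a [p [Oba pk E _]]]]|//] := swap_colP O' c.
have Oba' : O (~~ b) a by rewrite -OO'.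
move: Ec; rewrite E (swap_col_window sepO Oba' pk) (swap_col_window sepO' Oba pk).
move=> /addnI Ep; congr (_ + _).
by rewrite -{2}(@shuffleK (~~ b) p) // Ep negbK.
Qed.

(** * Occurrences in a filling *)

Section Diagram.

Variables (n m : nat) (D : {set 'I_n * 'I_m}).

Implicit Types F G : {set 'I_n * 'I_m}.

(** Coordinates are natural numbers, with no cell outside the grid, so that columns [a + p] need no
    bound proofs. *)
Definition cell F (c r : nat) : bool :=
  [exists x in F, (val x.1 == c) && (val x.2 == r)].

Lemma cellP F c r :
  reflect (exists2 x, x \in F & val x.1 = c /\ val x.2 = r) (cell F c r).
Proof.
apply: (iffP exists_inP) => [[x Fx /andP[/eqP <- /eqP <-]]|[x Fx [<- <-]]].
  by exists x.
by exists x; rewrite // !eqxx.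
Qed.

Lemma cell_ord F (x : 'I_n * 'I_m) : cell F x.1 x.2 = (x \in F).
Proof.
apply/cellP/idP => [[[c r] Fy [/val_inj E1 /val_inj E2]]|Fx]; last by exists x.
by case: x E1 E2 => c' r' /= <- <-.
Qed.

Definition column_functional F : Prop :=
  forall c r r', cell F c r -> cell F c r' -> r = r'.

Lemma filling_column_functional F : filling D F -> column_functional F.
Proof.
case/andP=> _ /forall_inP fF c r r' /cellP[x Fx [<- <-]] /cellP[y Fy [Ec <-]].
have /implyP := forall_inP (fF x Fx) y Fy.
by rewrite -(inj_eq val_inj) Ec eqxx => /(_ isT)/eqP ->.
Qed.

Lemma filling_row_functional F c c' r :
  filling D F -> cell F c r -> cell F c' r -> c = c'.
Proof.
case/andP=> _ /forall_inP fF /cellP[x Fx [<- <-]] /cellP[y Fy [<- Er]].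
have /implyP := forall_inP (fF x Fx) y Fy.
by rewrite -!(inj_eq val_inj) Er eqxx orbT => /(_ isT)/eqP ->.
Qed.

(** Quantifying over pairs of positions collects the selected cells, the order pattern and the
    rectangle condition in one clause. *)
Definition occurs F (b : bool) (a : nat) : bool :=
  [forall p : 'I_k, forall q : 'I_k, exists i : 'I_m, exists j : 'I_m,
    [&& cell F (a + p) i, cell F (a + q) j, cell D (a + p) j
      & (i < j) == (nth 0 (P b) p < nth 0 (P b) q)]].

Lemma occursP F b a :
  reflect (forall p q, p < k -> q < k -> exists i j,
      [/\ cell F (a + p) i, cell F (a + q) j, cell D (a + p) j
        & (i < j) = (nth 0 (P b) p < nth 0 (P b) q)]) (occurs F b a).
Proof.
apply: (iffP idP) => [occ p q pk qk|occ].
  have /existsP[i /existsP[j /and4P[Fi Fj Dj /eqP ij]]] :=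
    forallP (forallP occ (Ordinal pk)) (Ordinal qk).
  by exists i, j.
apply/forallP => p; apply/forallP => q.
have [i [j [Fi Fj Dj ij]]] := occ p q (ltn_ord p) (ltn_ord q).
have /cellP[[ci ri] _ [_ /= Ei]] := Fi; have /cellP[[cj rj] _ [_ /= Ej]] := Fj.
by apply/existsP; exists ri; apply/existsP; exists rj; rewrite Ei Ej ij eqxx andbT; apply/and3P.
Qed.

Lemma occurs_separated F : column_functional F -> separated (occurs F).
Proof.
move=> funF b b' a d dk /occursP occ /occursP occ'; apply: (overlapP dk).
apply/allP => p; rewrite mem_iota sizeP => /andP[_ pd].
apply/allP => q; rewrite mem_iota => /andP[_ qd].
have [||i [j [Fi Fj _ <-]]] := occ (d + p) (d + q); [lia|lia|].
have [||i' [j' [Fi' Fj' _ <-]]] := occ' p q; [lia|lia|].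
rewrite !addnA in Fi Fj.
by rewrite (funF _ _ _ Fi Fi') (funF _ _ _ Fj Fj').
Qed.

Lemma containsP F b : column_functional F ->
  reflect (exists a, occurs F b a) (contains D F (P b)).
Proof.
move=> funF; apply: (iffP idP).
  case/existsP=> c /existsP[r /and4P[/forallP adj /forallP cr]].
  case/andP=> _ /forallP iso /forallP rect.
  have k0 : 0 < size (P b) by rewrite sizeP; lia.
  have Ec p (pk : p < size (P b)) :
      val (tnth c (Ordinal pk)) = tnth c (Ordinal k0) + p.
    elim: p pk => [|p IH] pk; first by rewrite addn0; congr (val (tnth c _)); apply: val_inj.
    have pk' : p < size (P b) by apply: ltnW.
    have /implyP/(_ (eqxx _))/eqP -> := forallP (adj (Ordinal pk')) (Ordinal pk).
    by rewrite (IH pk') addnS.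
  exists (tnth c (Ordinal k0)); apply/occursP => p q; rewrite -(sizeP b) => pk qk.
  exists (tnth r (Ordinal pk)), (tnth r (Ordinal qk)).
  have Hsz : size [seq val j | j <- r] = size (P b) by rewrite size_map size_tuple.
  have pk1 : p < size [seq val j | j <- r] by rewrite Hsz.
  have qk1 : q < size [seq val j | j <- r] by rewrite Hsz.
  have nthr i (ik : i < size (P b)) :
      nth 0 [seq val j | j <- r] i = tnth r (Ordinal ik).
    rewrite (nth_map (tnth r (Ordinal ik))) ?size_tuple //.
    by rewrite [in RHS](tnth_nth (tnth r (Ordinal ik))).
  rewrite -!Ec; split.
  - by rewrite (cell_ord F (tnth c _, tnth r _)).
  - by rewrite (cell_ord F (tnth c _, tnth r _)).
  - by rewrite (cell_ord D (tnth c _, tnth r _)); apply: (forallP (rect _)).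
  - have /eqP := forallP (iso (Ordinal pk1)) (Ordinal qk1).
    by rewrite /= !nthr.
case=> a /occursP occ.
have rowP p : p < k -> exists x : 'I_n * 'I_m, (x \in F) && (val x.1 == a + p).
  move=> pk; have [i [_ [/cellP[x Fx [Ex _]] _ _ _]]] := occ p p pk pk.
  by exists x; rewrite Fx Ex eqxx.
have ltk (p : 'I_(size (P b))) : p < k by rewrite -(sizeP b).
pose x (p : 'I_(size (P b))) : 'I_n * 'I_m := xchoose (rowP p (ltk p)).
have Fx p : x p \in F by case/andP: (xchooseP (rowP p (ltk p))).
have xa p : val (x p).1 = a + p by case/andP: (xchooseP (rowP p (ltk p))) => _ /eqP.
have Fxc (p : 'I_(size (P b))) : cell F (a + p) (x p).2 by rewrite -xa cell_ord.
apply/existsP; exists [tuple (x p).1 | p < size (P b)].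
apply/existsP; exists [tuple (x p).2 | p < size (P b)].
apply/and4P; split.
- apply/forallP => p; apply/forallP => q; apply/implyP => /eqP Eq.
  by rewrite !tnth_mktuple !xa Eq addnS.
- by apply/forallP => p; rewrite !tnth_mktuple -surjective_pairing.
- rewrite /order_iso size_map size_tuple eqxx /=.
  have nthx (p : 'I_(size (P b))) :
      nth 0 [seq val j | j <- [tuple (x p).2 | p < size (P b)]] p = (x p).2.
    rewrite (nth_map (x p).2) ?size_tuple // -tnth_nth tnth_mktuple //.
  apply/forallP => p; apply/forallP => q; rewrite !nthx.
  have [i [j [Fi Fj _ <-]]] := occ p q (ltk p) (ltk q).
  by rewrite (funF _ _ _ Fi (Fxc p)) (funF _ _ _ Fj (Fxc q)).
- apply/forallP => p; apply/forallP => q; rewrite !tnth_mktuple.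
  rewrite -(cell_ord D) /= xa.
  have [i [j [Fi Fj Dj _]]] := occ p q (ltk p) (ltk q).
  by rewrite -(funF _ _ _ Fj (Fxc q)).
Qed.

(** * The swap as an involution on fillings *)

Definition swap_filling F : {set 'I_n * 'I_m} :=
  [set x : 'I_n * 'I_m | cell F (swap_col (occurs F) x.1) x.2].

Lemma cell_swap F c r :
  cell (swap_filling F) c r = cell F (swap_col (occurs F) c) r.
Proof.
have [ltr|ger] := ltnP r m; last first.
  by apply/cellP/cellP => -[x _ [_ Er]]; have := ltn_ord x.2; rewrite Er ltnNge ger.
have [ltc|gec] := ltnP c n.
  by rewrite (cell_ord _ (Ordinal ltc, Ordinal ltr)) inE.
(* A column beyond the grid lies in no occurrence, since each column of an occurrence holds a
   cell. *)
have [[b [a [p [/occursP occ pk Ec _]]]]|->] := swap_colP (occurs F) c.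
  have [i [_ [/cellP[x _ [Ex _]] _ _ _]]] := occ p p pk pk.
  by have := ltn_ord x.1; rewrite Ex -Ec ltnNge gec.
by apply/cellP/cellP => -[x _ [Ec _]]; have := ltn_ord x.1; rewrite Ec ltnNge gec.
Qed.

Lemma swap_column_functional F :
  column_functional F -> column_functional (swap_filling F).
Proof. by move=> funF c r r'; rewrite !cell_swap; apply: funF. Qed.

Lemma occurs_swap_sub F b a : column_functional F ->
  occurs F b a -> occurs (swap_filling F) (~~ b) a.
Proof.
move=> funF occF; have sepF := occurs_separated funF.
have /occursP occ := occF; apply/occursP => p q pk qk.
have [i [j [Fi Fj _ ij]]] := occ _ _ (shuffle_lt b pk) (shuffle_lt b qk).
(* The rectangle condition is needed at the unshuffled column [a + p], against the row that moves
   into column [a + q]. *)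
have [_ [j' [_ Fj' Dj _]]] := occ _ _ pk (shuffle_lt b qk).
exists i, j; split; rewrite ?cell_swap ?(swap_col_window sepF occF) //.
  by rewrite (funF _ _ _ Fj Fj').
by rewrite ij !nth_shuffle.
Qed.

(* An occurrence in the new filling that overlaps a swapped one coincides with
   it; otherwise none of its columns moves, so it was present before the swap,
   and should have been swapped itself. *)
Lemma occurs_swap F b a : column_functional F ->
  occurs (swap_filling F) b a = occurs F (~~ b) a.
Proof.
move=> funF; apply/idP/idP => [occ'|occ]; last first.
  by rewrite -(negbK b); apply: occurs_swap_sub.
have sepF := occurs_separated funF.
have sepF' := occurs_separated (swap_column_functional funF).
apply/contraT => nocc.
have farF b' a' : occurs F b' a' -> a' + k.-1 <= a \/ a + k.-1 <= a'.
  move=> occ; have occ1 := occurs_swap_sub funF occ.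
  have [|lt1] := leqP (a' + k.-1) a; first by left.
  have [|lt2] := leqP (a + k.-1) a'; first by right.
  case/negP: nocc; have [le_aa'|/ltnW le_a'a] := leqP a a'.
    have [|||E ->] := sepF' b (~~ b') a (a' - a); rewrite ?subnKC //; first by lia.
    have <- : a' = a by lia.
    by rewrite negbK.
  have [|||E <-] := sepF' (~~ b') b a' (a - a'); rewrite ?subnKC //; first by lia.
  have <- : a' = a by lia.
  by rewrite negbK.
have occ : occurs F b a.
  apply/occursP => p q pk qk; have [i [j []]] := occursP _ _ _ occ' p q pk qk.
  by rewrite !cell_swap !swap_col_far // => Fi Fj Dj ij; exists i, j.
(* The occurrence at [a] would have to be far from itself. *)
by case: (farF _ _ occ); lia.
Qed.

Lemma swap_fillingK F : column_functional F ->
  swap_filling (swap_filling F) = F.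
Proof.
move=> funF; have funF' := swap_column_functional funF.
apply/setP => x; rewrite -2!cell_ord !cell_swap (swap_colK (O' := occurs F)) //.
- exact: occurs_separated.
- exact: occurs_separated.
- by move=> b a; rewrite occurs_swap // negbK.
Qed.

Lemma swap_colKF F c : column_functional F ->
  swap_col (occurs (swap_filling F)) (swap_col (occurs F) c) = c.
Proof.
move=> funF; have funF' := swap_column_functional funF.
apply: swap_colK => [||b a]; try exact: occurs_separated.
exact: occurs_swap.
Qed.

(** Moved cells stay in [D] by the rectangle condition; rows stay distinct because [swap_col] has a
    left inverse. *)
Lemma swap_filling_filling F : filling D F -> filling D (swap_filling F).
Proof.
move=> fF; have funF := filling_column_functional fF.
apply/andP; split.
  apply/subsetP => x; rewrite -!cell_ord cell_swap.
  have [[b [a [p [/occursP occ pk -> ->]]]]|->] := swap_colP (occurs F) x.1.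
    have [_ [j [_ Fj Dj _]]] := occ _ _ pk (shuffle_lt b pk).
    by move=> Fx; rewrite (funF _ _ _ Fx Fj).
  by rewrite !cell_ord; apply: (subsetP (proj1 (andP fF))).
apply/forall_inP => x; rewrite -cell_ord => Fx.
apply/forall_inP => y; rewrite -cell_ord => Fy.
apply/implyP => /orP[/eqP E1|/eqP E2].
  rewrite -E1 in Fy.
  have /val_inj E2 := swap_column_functional funF Fx Fy.
  by case: x y E1 E2 {Fx Fy} => ? ? [? ?] /= -> ->.
rewrite -E2 in Fy; rewrite !cell_swap in Fx Fy.
have /(congr1 (swap_col (occurs (swap_filling F)))) := filling_row_functional fF Fx Fy.
rewrite !swap_colKF // => /val_inj E1.
by case: x y E1 E2 {Fx Fy} => ? ? [? ?] /= -> ->.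
Qed.

(** * Empty rows and columns, and counting *)

Lemma empty_rowsP F (r : 'I_m) : reflect (forall c, ~~ cell F c r) (r \in empty_rows F).
Proof.
rewrite inE; apply: (iffP forallP) => [eF c|eF c]; last by rewrite -cell_ord.
apply/negP => /cellP[x Fx [_ /val_inj Er]]; case/negP: (eF x.1).
by rewrite -Er -surjective_pairing.
Qed.

Lemma empty_columnsP F (c : 'I_n) :
  reflect (forall r, ~~ cell F c r) (c \in empty_columns F).
Proof.
rewrite inE; apply: (iffP forallP) => [eF r|eF r]; last by rewrite -cell_ord.
apply/negP => /cellP[x Fx [/val_inj Ec _]]; case/negP: (eF x.2).
by rewrite -Ec -surjective_pairing.
Qed.

Lemma empty_rows_swap F : column_functional F ->
  empty_rows (swap_filling F) = empty_rows F.
Proof.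
move=> funF; apply/setP => r; apply/empty_rowsP/empty_rowsP => eF c.
  have funF' := swap_column_functional funF.
  have := eF (swap_col (occurs (swap_filling F)) c); rewrite cell_swap.
  (* Reading this [F] as a double swap lets [swap_colKF] apply to the swapped filling. *)
  by rewrite -{2}(swap_fillingK funF) swap_colKF.
by rewrite cell_swap.
Qed.

(** Columns of an occurrence are occupied before and after the swap; all others are unchanged. *)
Lemma empty_columns_swap F : empty_columns (swap_filling F) = empty_columns F.
Proof.
apply/setP => c; apply/empty_columnsP/empty_columnsP => eF r; move: (eF);
  rewrite ?cell_swap; have [[b [a [p [/occursP occ pk E1 E2]]]]|E] := swap_colP (occurs F) c.
- have [i [_ [Fi _ _ _]]] := occ _ _ (shuffle_lt b pk) pk.
  by move/(_ i); rewrite cell_swap E2 Fi.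
- by move/(_ r); rewrite cell_swap E.
- have [i [_ [Fi _ _ _]]] := occ _ _ pk pk.
  by move/(_ i); rewrite E1 Fi.
- by rewrite E.
Qed.

(** The swap is injective, being its own inverse; the inequality for both values of [b] gives
    equality. *)
Lemma leq_avoiding_fillings b R C :
  #|avoiding_fillings D (P b) R C| <= #|avoiding_fillings D (P (~~ b)) R C|.
Proof.
have swapK : {in avoiding_fillings D (P b) R C, cancel swap_filling swap_filling}.
  by move=> F; rewrite inE => /andP[/filling_column_functional/swap_fillingK].
rewrite -(card_in_imset (can_in_inj swapK)).
apply/subset_leq_card/subsetP => _ /imsetP[F + ->]; rewrite !inE.
case/and4P=> fF avoid eR eC; have funF := filling_column_functional fF.
rewrite swap_filling_filling // empty_rows_swap // empty_columns_swap eR eC !andbT /=.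
apply: contra avoid => /containsP[|a]; first exact: swap_column_functional.
rewrite occurs_swap // negbK => occ; apply/containsP => //; by exists a.
Qed.

End Diagram.

Lemma fs_equiv_swap : fs_equiv (P true) (P false).
Proof.
move=> n m D _ R C; apply/eqP.
by rewrite eqn_leq (leq_avoiding_fillings D true) (leq_avoiding_fillings D false).
Qed.

End SwapPatterns.

(** A computable form of the section hypotheses. At shift 0 only mixed overlaps are excluded, as a
    pattern always overlaps itself there; the other shifts run from 1 to [k - 2]. *)
Definition swappable (s t : seq nat) : bool :=
  [&& size s == size t, 2 < size s, nth 0 s 0 == nth 0 t 0,
      nth 0 s (size s).-1 == nth 0 t (size s).-1,
      ~~ overlap s t 0, ~~ overlap t s 0
    & all (fun d => ~~ [|| overlap s s d, overlap s t d, overlap t s d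
                         | overlap t t d]) (iota 1 (size s).-2)].

Lemma swappable_fs_equiv (s t : pattern) : swappable s t -> fs_equiv s t.
Proof.
case/and4P=> /eqP Esz gt2 /eqP E0 /and4P[/eqP El st0 ts0 /allP nov].
apply: (@fs_equiv_swap (fun b => if b then s else t) (size s)) => //.
  by case.
move=> b b' [|d] ltd ov; first by case: b b' ov => -[] //; [rewrite (negPf st0) | rewrite (negPf ts0)].
have /nov : d.+1 \in iota 1 (size s).-2 by rewrite mem_iota; lia.
by rewrite !negb_or => /and4P[/negPf ss /negPf st /negPf ts /negPf tt];
  case: b b' ov => -[]; rewrite ?ss ?st ?ts ?tt.
Qed.

Theorem corollary3p7 :
  (fs_equiv (@Pattern [:: 1; 3; 4; 5; 2] isT) (@Pattern [:: 1; 3; 5; 4; 2] isT) /\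
   fs_equiv (@Pattern [:: 1; 3; 5; 4; 2] isT) (@Pattern [:: 1; 4; 3; 5; 2] isT) /\
   fs_equiv (@Pattern [:: 1; 4; 3; 5; 2] isT) (@Pattern [:: 1; 4; 5; 3; 2] isT) /\
   fs_equiv (@Pattern [:: 1; 4; 5; 3; 2] isT) (@Pattern [:: 1; 5; 3; 4; 2] isT) /\
   fs_equiv (@Pattern [:: 1; 5; 3; 4; 2] isT) (@Pattern [:: 1; 5; 4; 3; 2] isT)) /\
  fs_equiv (@Pattern [:: 1; 2; 4; 5; 3] isT) (@Pattern [:: 1; 2; 5; 4; 3] isT) /\
  fs_equiv (@Pattern [:: 2; 4; 1; 5; 3] isT) (@Pattern [:: 2; 5; 1; 4; 3] isT).
(* Each pair agrees in its first and last entries, and the overlap conditions are a finite check. *)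
Proof. by do !split; apply: swappable_fs_equiv; vm_compute. Qed.
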